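(* Let $m\ge1$ be an integer, let $c>1$ be a real constant, and let $N=\lfloor c\,2^m n\rfloor$. Let $\omega(n)$ be any function with $\omega(n)\to\infty$ as $n\to\infty$, growing slowly enough that $\frac{1}{c^{1/m}}\big(1+\frac{\omega(n)}{n}\big)\in[0,1]$. Then there is a constant $M=M(c,m)>0$ such that $$\frac{1}{c^{1/m}}\Big(1+\frac{\omega(n)}{n}\Big)\quad\text{and}\quad \frac{1}{c^{1/m}}\Big(1-\sqrt{\frac{M\log n}{n}}\,\Big)$$ are a weak Ramsey upper threshold and a weak Ramsey lower threshold of $K_{m,n}$ in $\mathcal{G}(N,p)$, respectively.
   Context: All graphs are finite and simple. $K_{m,n}$ is the complete bipartite graph with parts of sizes $m$ and $n$. $\mathcal{G}(N,p)$ is the Erdős–Rényi random graph space on a labelled vertex set of size $N$, in which each edge of $K_N$ appears independently with probability $p$. $G\subseteq F$ means that $F$ contains a copy of $G$ as a (not necessarily induced) subgraph. Probability functions $p_u=p_u(N)$ and $p_\ell=p_\ell(N)$ are called a weak Ramsey upper threshold and a weak Ramsey lower threshold of $G$ in $\mathcal{G}(N,p)$, respectively, if $$\lim_{N\to\infty}\Pr[F\in\mathcal{G}(N,p/2): G\subseteq F]=\begin{cases}1&\text{for } p\ge p_u,\\ 0&\text{for } p\le p_\ell,\end{cases}$$ where $p=p(N)\in[0,1]$ may depend on $N$ (note the edge probability $p/2$). Here $G=K_{m,n}$ depends on $n$, with $N=\lfloor c2^mn\rfloor$ and $m,c$ fixed, so the limit is taken as $n\to\infty$; the lower threshold is considered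 for $n$ large enough that it is nonnegative. *)

(* Defs.v *)
From HB Require Import structures.
From mathcomp Require Import all_boot all_order all_algebra.
From mathcomp Require Import all_classical all_reals all_analysis.

Set Implicit Arguments.
Unset Strict Implicit.
Unset Printing Implicit Defensive.

Import Order.TTheory GRing.Theory Num.Theory.
Import numFieldNormedType.Exports.

Local Open Scope classical_set_scope.
Local Open Scope ring_scope.

Definition vpairs (V : finType) : {set {set V}} :=
  [set e : {set V} | #|e| == 2]%SET.

Record sgraph (V : finType) := SGraph {
  edges : {set {set V}};
  edges_vpairs : edges \subset vpairs V
}.

HB.instance Definition _ (V : finType) := [isSub of sgraph V for @edges V].
HB.instance Definition _ (V : finType) := [Finite of sgraph V by <:].

(* The copy of G in F need not be induced: only edges are required to be sent
   to edges. *)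
Definition contains_copy (U V : finType) (G : sgraph U) (F : sgraph V) : bool :=
  [exists f : {ffun U -> V},
     injectiveb f && [forall e in edges G, (f @: e)%SET \in edges F]].

Definition Kmn_edges (m n : nat) : {set {set ('I_m + 'I_n)}} :=
  [set [set inl i; inr j] | i : 'I_m, j : 'I_n]%SET.

Lemma Kmn_edges_vpairs (m n : nat) :
  Kmn_edges m n \subset vpairs ('I_m + 'I_n)%type.
Proof. by apply/fintype.subsetP => _ /imset2P[i j _ _ ->]; rewrite inE cards2. Qed.

Definition Kmn (m n : nat) : sgraph ('I_m + 'I_n)%type :=
  SGraph (Kmn_edges_vpairs m n).

(* The probability of the outcome F in G(N, q): each pair of vertices is an
   edge independently with probability q. *)
Definition Gnp_weight (R : realType) (N : nat) (q : R) (F : sgraph 'I_N) : R :=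
  \prod_(e in vpairs 'I_N) (if e \in edges F then q else 1 - q).

Definition Gnp_prob (R : realType) (N : nat) (q : R) (A : pred (sgraph 'I_N)) : R :=
  \sum_(F : sgraph 'I_N | A F) Gnp_weight q F.

(* For a family of graphs G n, with N n the number of vertices of the random
   graph, all threshold functions are indexed by n rather than by N n.  The
   comparison of p with a threshold is only required for n large enough, as a
   lower threshold may be negative for small n. *)
Definition weak_Ramsey_upper_threshold (R : realType) (U : nat -> finType)
    (G : forall n, sgraph (U n)) (N : nat -> nat) (pu : nat -> R) : Prop :=
  forall p : nat -> R,
    (forall n, 0 <= p n <= 1) ->
    (\forall n \near \oo, pu n <= p n) ->
    Gnp_prob (p n / 2) (fun F : sgraph 'I_(N n) => contains_copy (G n) F)
      @[n --> \oo] --> (1 : R).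

Definition weak_Ramsey_lower_threshold (R : realType) (U : nat -> finType)
    (G : forall n, sgraph (U n)) (N : nat -> nat) (pl : nat -> R) : Prop :=
  forall p : nat -> R,
    (forall n, 0 <= p n <= 1) ->
    (\forall n \near \oo, p n <= pl n) ->
    Gnp_prob (p n / 2) (fun F : sgraph 'I_(N n) => contains_copy (G n) F)
      @[n --> \oo] --> (0 : R).

(* Main.v *)
(* Upper threshold: if F has no K_{m,n}, counting pairs (f, v) where v is joined
   to all the f i shows that the sum of the deg(v)^m is at most N^m (n + m^2)
   (Kovari-Sos-Turan).  By convexity this sum is at least N a^m where a is the
   average degree.  Chebyshev's inequality for the number of edges gives
   a > N q - 1 - s with probability at least 1 - 2 / s^2, where q = p / 2; taking
   s = omega / (4 m), the excess of order omega of N q^m over n absorbs the loss.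

   Lower threshold: for a fixed injection f, the number X of common neighbours of
   the f i satisfies E[(1 + x)^X] <= (1 + x q^m)^N.  Markov's inequality with
   x = delta / 2, delta = sqrt(M log n / n), together with a union bound over
   the at most N^m injections, leaves O(n^m n^(- M / 4)), which is O(1 / n) for
   M = 4 (m + 1). *)
Require Import Defs.
From mathcomp Require Import all_boot all_order all_algebra.
From mathcomp Require Import all_classical all_reals all_analysis.
From mathcomp Require Import ring lra zify.

Import Order.TTheory GRing.Theory Num.Theory.
Import numFieldNormedType.Exports.

Set Implicit Arguments.
Unset Strict Implicit.
Unset Printing Implicit Defensive.

Local Open Scope ring_scope.

(** * Expanding products over subsets *)

Lemma prodrD_subsets (R : comNzRingType) (I : finType) (a b : I -> R) :
  \prod_i (a i + b i) =
  \sum_(J : {set I}) \prod_i (if i \in J then a i else b i).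
Proof. by rewrite bigA_distr; apply: eq_bigl => J; rewrite inE. Qed.

(** An index in [C] contributes the factor [x + 1] and any other index the factor [0 + 1]. *)
Lemma sum_subsets_expr (R : comNzRingType) (I : finType) (C : {set I}) (x : R) :
  \sum_(T : {set I}) x ^+ #|T| * (T \subset C)%:R = (x + 1) ^+ #|C|.
Proof.
rewrite -prodr_const [RHS]big_mkcond /=.
rewrite (eq_bigr (fun i => (if i \in C then x else 0) + 1)) => [|i _]; last first.
  by case: ifP; rewrite ?add0r.
rewrite prodrD_subsets; apply: eq_bigr => T _.
rewrite -big_mkcond /=; have [sTC|/subsetPn[i iT iC]] := boolP (T \subset C).
  rewrite mulr1 -prodr_const; apply: eq_bigr => i iT.
  by rewrite (fintype.subsetP sTC).
by rewrite mulr0 (bigD1 i) //= (negbTE iC) mul0r.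
Qed.

(** * Probability and expectation in [G(N, q)] *)

Lemma Gnp_weight_ge0 (R : realType) (N : nat) (q : R) (F : sgraph 'I_N) :
  0 <= q <= 1 -> 0 <= Gnp_weight q F.
Proof.
move=> /andP[q0 q1]; apply: prodr_ge0 => e _.
by case: ifP => // _; rewrite subr_ge0.
Qed.

(** Pairs outside [E] are unconstrained and contribute [q + (1 - q) = 1]. Independence enters the
    later moment computations through this formula. *)
Lemma Gnp_prob_subset (R : realType) (N : nat) (q : R) (E : {set {set 'I_N}}) :
  E \subset vpairs 'I_N -> Gnp_prob q (fun F => E \subset edges F) = q ^+ #|E|.
Proof.
move=> sEP.
(* [a] and [b] are the weights of [e] being present or absent. Their zeros keep only the [J] with
   [E \subset J \subset vpairs 'I_N], which are the edge sets of the graphs containing [E]; the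
   value 1 of [b] makes non-pairs neutral. *)
pose a (e : {set 'I_N}) : R := if e \in vpairs 'I_N then q else 0.
pose b (e : {set 'I_N}) : R :=
  if e \in E then 0 else if e \in vpairs 'I_N then 1 - q else 1.
have -> : q ^+ #|E| = \prod_e (a e + b e).
  rewrite (bigID (mem E)) /= [X in _ * X]big1 ?mulr1 => [|e /negbTE eE].
    rewrite -prodr_const; apply: eq_bigr => e eE.
    by rewrite /a /b eE (fintype.subsetP sEP) ?addr0.
  by rewrite /a /b eE; case: ifP => _; rewrite ?add0r // addrC subrK.
rewrite prodrD_subsets.
rewrite (bigID (fun J : {set {set 'I_N}} => (J \subset vpairs 'I_N) && (E \subset J))) /=.
rewrite [X in _ + X]big1 ?addr0 => [|J]; last first.
  rewrite negb_and => /orP[] /subsetPn[e ein eout].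
    by rewrite (bigD1 e) //= ein /a (negbTE eout) mul0r.
  by rewrite (bigD1 e) //= (negbTE eout) /b ein mul0r.
rewrite /Gnp_prob (reindex_omap (@edges _) (fun J => insub J)) /=.
  apply: eq_big => [F|F sEF].
    by rewrite edges_vpairs /= (valK F) eqxx andbT.
  rewrite /Gnp_weight big_mkcond /=; apply: eq_bigr => e _.
  rewrite /a /b; have [ein|eout] := boolP (e \in edges F).
    by rewrite (fintype.subsetP (edges_vpairs F)).
  by rewrite (negbTE (contra (fintype.subsetP sEF e) eout)).
by move=> J /andP[sJ _]; rewrite insubT.
Qed.

Definition Gnp_mean (R : realType) (N : nat) (q : R) (X : sgraph 'I_N -> R) : R :=
  \sum_F Gnp_weight q F * X F.

Lemma Gnp_mean_indicator (R : realType) (N : nat) (q : R) (A : pred (sgraph 'I_N)) :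
  Gnp_mean q (fun F => (A F)%:R) = Gnp_prob q A.
Proof.
rewrite /Gnp_mean /Gnp_prob [RHS]big_mkcond; apply: eq_bigr => F _.
by case: (A F); rewrite ?mulr1 ?mulr0.
Qed.

Lemma Gnp_mean_sum (R : realType) (N : nat) (q : R) (I : finType) (P : pred I)
    (X : I -> sgraph 'I_N -> R) :
  Gnp_mean q (fun F => \sum_(i | P i) X i F) = \sum_(i | P i) Gnp_mean q (X i).
Proof.
by rewrite exchange_big; apply: eq_bigr => F _; rewrite mulr_sumr.
Qed.

Lemma Gnp_meanZ (R : realType) (N : nat) (q a : R) (X : sgraph 'I_N -> R) :
  Gnp_mean q (fun F => a * X F) = a * Gnp_mean q X.
Proof. by rewrite mulr_sumr; apply: eq_bigr => F _; rewrite mulrCA. Qed.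

Lemma Gnp_meanD (R : realType) (N : nat) (q : R) (X Y : sgraph 'I_N -> R) :
  Gnp_mean q (fun F => X F + Y F) = Gnp_mean q X + Gnp_mean q Y.
Proof. by rewrite -big_split; apply: eq_bigr => F _; rewrite mulrDr. Qed.

(** The sure event is that of containing the empty edge set, of probability [q ^+ 0]. *)
Lemma Gnp_prob_setT (R : realType) (N : nat) (q : R) :
  Gnp_prob q (fun _ : sgraph 'I_N => true) = 1.
Proof.
rewrite -(expr0 q) -(@cards0 {set 'I_N}) -Gnp_prob_subset ?finset.sub0set //.
by apply: eq_bigl => F; rewrite finset.sub0set.
Qed.

Lemma Gnp_mean_cst (R : realType) (N : nat) (q a : R) :
  Gnp_mean q (fun _ : sgraph 'I_N => a) = a.
Proof. by rewrite /Gnp_mean -mulr_suml [X in X * _]Gnp_prob_setT mul1r. Qed.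

Lemma ler_Gnp_mean (R : realType) (N : nat) (q : R) (X Y : sgraph 'I_N -> R) :
  0 <= q <= 1 -> (forall F, X F <= Y F) -> Gnp_mean q X <= Gnp_mean q Y.
Proof.
by move=> q01 leXY; apply: ler_sum => F _; rewrite ler_wpM2l ?Gnp_weight_ge0.
Qed.

Lemma Gnp_prob_ge0 (R : realType) (N : nat) (q : R) (A : pred (sgraph 'I_N)) :
  0 <= q <= 1 -> 0 <= Gnp_prob q A.
Proof. by move=> q01; apply: sumr_ge0 => F _; apply: Gnp_weight_ge0. Qed.

Lemma Gnp_probC (R : realType) (N : nat) (q : R) (A : pred (sgraph 'I_N)) :
  Gnp_prob q A = 1 - Gnp_prob q (fun F => ~~ A F).
Proof. by rewrite -(Gnp_prob_setT N q) [in RHS]/Gnp_prob (bigID A) /= addrK. Qed.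

Lemma Gnp_markov (R : realType) (N : nat) (q t : R) (A : pred (sgraph 'I_N))
    (X : sgraph 'I_N -> R) :
  0 <= q <= 1 -> (forall F, 0 <= X F) -> (forall F, A F -> t <= X F) ->
  t * Gnp_prob q A <= Gnp_mean q X.
Proof.
move=> q01 X0 AX; rewrite -Gnp_mean_indicator -Gnp_meanZ.
apply: ler_Gnp_mean => // F; have [AF|_] := boolP (A F).
  by rewrite mulr1 AX.
by rewrite mulr0.
Qed.

(** * Second moment of the number of edges *)

(** The edge count is a sum of indicators over pairs. Distinct pairs are independent, so only the
    diagonal terms contribute. *)
Lemma Gnp_variance_edges (R : realType) (N : nat) (q : R) :
  Gnp_mean q (fun F : sgraph 'I_N =>
    (#|edges F|%:R - 'C(N, 2)%:R * q) ^+ 2) = 'C(N, 2)%:R * (q * (1 - q)).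
Proof.
have cP : #|vpairs 'I_N| = 'C(N, 2) by rewrite card_draws card_ord.
set P := 'C(N, 2)%:R.
have P_sum (x : R) : \sum_(e in vpairs 'I_N) x = P * x.
  by rewrite sumr_const cP mulr_natl.
have eE (F : sgraph 'I_N) :
    #|edges F|%:R = \sum_(e in vpairs 'I_N) (e \in edges F)%:R :> R.
  rewrite -sum1_card natr_sum [RHS]big_mkcond [LHS]big_mkcond.
  apply: eq_bigr => e _; have [eF|_] := boolP (e \in edges F).
    by rewrite (fintype.subsetP (edges_vpairs F)).
  by case: ifP.
(* The set [[set e; f]] has one or two elements, so the joint probability is [q] or [q ^+ 2]. *)
have mean2 (e f : {set 'I_N}) : e \in vpairs 'I_N -> f \in vpairs 'I_N ->
    Gnp_mean q (fun F => (e \in edges F)%:R * (f \in edges F)%:R) =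
    q ^+ 2 + (if e == f then q - q ^+ 2 else 0).
  move=> eP fP.
  have -> : Gnp_mean q (fun F => (e \in edges F)%:R * (f \in edges F)%:R) =
            Gnp_mean q (fun F => ([set e; f]%SET \subset edges F)%:R).
    by apply: eq_bigr => F _; rewrite finset.subUset !finset.sub1set -natrM mulnb.
  rewrite Gnp_mean_indicator Gnp_prob_subset; last first.
    by rewrite finset.subUset !finset.sub1set eP.
  rewrite cards2; case: eqVneq => _ /=; first by rewrite expr1 addrC subrK.
  by rewrite addr0.
have mean1 (e : {set 'I_N}) : e \in vpairs 'I_N ->
    Gnp_mean q (fun F => (e \in edges F)%:R) = q.
  move=> eP; rewrite Gnp_mean_indicator -[RHS]expr1 -(cards1 e).
  rewrite -Gnp_prob_subset ?finset.sub1set //.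
  by apply: eq_bigl => F; rewrite finset.sub1set.
have m1 : Gnp_mean q (fun F : sgraph 'I_N => #|edges F|%:R) = P * q.
  rewrite -P_sum -(eq_bigr _ mean1) -Gnp_mean_sum.
  by apply: eq_bigr => F _; rewrite eE.
have m2 : Gnp_mean q (fun F : sgraph 'I_N => #|edges F|%:R ^+ 2) =
    P * (P * q ^+ 2 + (q - q ^+ 2)).
  have -> : Gnp_mean q (fun F : sgraph 'I_N => #|edges F|%:R ^+ 2) =
     \sum_(e in vpairs 'I_N) \sum_(f in vpairs 'I_N)
       Gnp_mean q (fun F => (e \in edges F)%:R * (f \in edges F)%:R).
    under eq_bigr do rewrite -Gnp_mean_sum.
    rewrite -Gnp_mean_sum; apply: eq_bigr => F _.
    rewrite expr2 eE mulr_suml; congr (_ * _).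
    by apply: eq_bigr => e _; rewrite mulr_sumr.
  rewrite -[RHS]P_sum; apply: eq_bigr => e eP.
  rewrite (eq_bigr _ (fun f => @mean2 e f eP)) big_split /= P_sum; congr (_ + _).
  rewrite (bigD1 e) //= eqxx big1 ?addr0 // => f /andP[_ /negbTE].
  by rewrite eq_sym => ->.
have -> : Gnp_mean q (fun F : sgraph 'I_N => (#|edges F|%:R - P * q) ^+ 2) =
  Gnp_mean q (fun F : sgraph 'I_N => #|edges F|%:R ^+ 2 +
     (- (2 * (P * q)) * #|edges F|%:R + (P * q) ^+ 2)).
  by apply: eq_bigr => F _; congr (_ * _); ring.
by rewrite !Gnp_meanD Gnp_meanZ Gnp_mean_cst m1 m2; ring.
Qed.

(** Chebyshev's inequality: the degree sum has mean [N (N - 1) q >= N (N q - 1)], so [A] forces the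
    edge count to deviate by at least [N s / 2]. *)
Lemma Gnp_edges_lower_tail (R : realType) (N : nat) (q s : R)
    (A : pred (sgraph 'I_N)) :
  0 <= q <= 1 -> 0 < s ->
  (forall F, A F -> 2 * #|edges F|%:R <= N%:R * (N%:R * q - 1 - s)) ->
  (0 < N)%N ->
  Gnp_prob q A <= 2 / s ^+ 2.
Proof.
move=> q01 s0 hA N0; have /andP[q0 q1] := q01.
have P2 : 2 * 'C(N, 2)%:R = N%:R * (N%:R - 1) :> R.
  rewrite -natrM -(mul_bin_diag N 1) bin1 natrM.
  by case: N N0 {A hA} => // N _; rewrite -(natr1 N) addrK.
have N0r : 0 < N%:R :> R by rewrite ltr0n.
have N1r : 1 <= N%:R :> R by rewrite ler1n.
have := @Gnp_markov R N q ((N%:R * s / 2) ^+ 2) A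
  (fun F => (#|edges F|%:R - 'C(N, 2)%:R * q) ^+ 2) q01 (fun F => sqr_ge0 _).
rewrite Gnp_variance_edges => H.
have {}H : (N%:R * s / 2) ^+ 2 * Gnp_prob q A <= 'C(N, 2)%:R * (q * (1 - q)).
  apply: H => F AF; rewrite -[leRHS]sqrrN lerXn2r ?nnegrE //.
  - by rewrite divr_ge0 // mulr_ge0 // ltW.
  - have := hA F AF; have : 0 <= N%:R * s by rewrite mulr_ge0 // ltW.
    have : N%:R * q <= N%:R by rewrite ler_piMr // ltW.
    nra.
  - have := hA F AF; have : N%:R * q <= N%:R by rewrite ler_piMr // ltW.
    nra.
have q4 : q * (1 - q) <= 1 by nra.
have P0 : 0 <= 'C(N, 2)%:R :> R by [].
have {}H : (N%:R * s / 2) ^+ 2 * Gnp_prob q A <= N%:R ^+ 2 / 2.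
  apply: (le_trans H); apply: (@le_trans _ _ ('C(N, 2)%:R)).
    by rewrite ler_piMr.
  nra.
rewrite ler_pdivlMr ?exprn_gt0 // -(ler_pM2l (exprn_gt0 2 N0r)).
nra.
Qed.

(** * Copies of [Kmn m n] and common neighbourhoods *)

Definition nbrs (V : finType) (F : sgraph V) (v : V) : {set V} :=
  [set u | [set u; v]%SET \in edges F]%SET.

Definition common_nbrs (m : nat) (V : finType) (F : sgraph V)
    (f : {ffun 'I_m -> V}) : {set V} :=
  [set v | [forall i, [set f i; v]%SET \in edges F]]%SET.

Lemma edges_neq (V : finType) (F : sgraph V) (u v : V) :
  [set u; v]%SET \in edges F -> u != v.
Proof.
by move=> /(fintype.subsetP (edges_vpairs F)); rewrite inE cards2; case: (u != v).
Qed.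

(** [f] places the side of size [m], and any [n] common neighbours form the other side. The sides
    are disjoint because the two ends of an edge differ. *)
Lemma contains_KmnP (m n : nat) (V : finType) (F : sgraph V) :
  reflect (exists2 f : {ffun 'I_m -> V}, injectiveb f & (n <= #|common_nbrs F f|)%N)
    (contains_copy (Kmn m n) F).
Proof.
apply: (iffP existsP) => [[g /andP[/injectiveP ginj /forallP gE]]|[f finj nf]].
  exists [ffun i => g (inl i)].
    by apply/injectiveP => i j; rewrite !ffunE => /ginj[].
  have cN : #|((fun j => g (inr j)) @: [set: 'I_n])%SET| = n.
    by rewrite card_imset ?cardsT ?card_ord // => i j /ginj[].
  rewrite -[leqLHS]cN; apply/subset_leq_card/fintype.subsetP => _ /imsetP[j _ ->].
  rewrite inE; apply/forallP => i; rewrite ffunE.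
  have /implyP := gE [set inl i; inr j]%SET.
  rewrite imsetU !imset_set1; apply.
  by apply/imset2P; exists i j.
pose g (u : 'I_m + 'I_n) : V :=
  match u with inl i => f i | inr j => enum_val (widen_ord nf j) end.
have gE i j : [set f i; g (inr j)]%SET \in edges F.
  have := enum_valP (widen_ord nf j).
  by rewrite inE => /forallP/(_ i).
exists [ffun u => g u]; apply/andP; split.
  apply/injectiveP => -[i|j] [i'|j']; rewrite !ffunE //=.
  - by move=> /(injectiveP _ finj) ->.
  - by move=> eij; have := edges_neq (gE i j'); rewrite eij eqxx.
  - by move=> eij; have := edges_neq (gE i' j); rewrite -eij eqxx.
  - by move=> /enum_val_inj/(congr1 val)/= /val_inj ->.
apply/forallP => e; apply/implyP => /imset2P[i j _ _ ->].
by rewrite imsetU !imset_set1 !ffunE gE.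
Qed.

(** * Degree sums and convexity *)

Lemma sum_deg_edges (V : finType) (F : sgraph V) :
  (\sum_v #|nbrs F v| = 2 * #|edges F|)%N.
Proof.
have -> : (2 * #|edges F| = \sum_(e in edges F) #|e|)%N.
  rewrite mulnC -sum_nat_const; apply: eq_bigr => e.
  by move=> /(fintype.subsetP (edges_vpairs F)); rewrite inE => /eqP.
under [RHS]eq_bigr do rewrite -sum1_card.
rewrite (exchange_big_dep xpredT) //= [LHS](eq_bigr (fun v => \sum_(e in edges F | v \in e) 1)%N) //.
(* For fixed [v], sending [u] to [[set u; v]] is a bijection from the neighbours of [v] to the edges
   through [v]. *)
move=> v _; rewrite sum1dep_card -(card_in_imset (f := fun u => [set u; v]%SET)).
  apply: eq_card => e; rewrite !inE; apply/imsetP/andP => [[u]|[eF ve]].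
    by rewrite inE => uv ->; rewrite uv !inE eqxx orbT.
  have := fintype.subsetP (edges_vpairs F) e eF.
  rewrite inE => /cards2P[x [y [xy eE]]].
  rewrite eE in eF ve *; case/set2P: ve => ->; last by exists x; rewrite ?inE.
  by exists y; rewrite ?inE finset.setUC.
move=> x y; rewrite !inE => /edges_neq xv /edges_neq yv /setP /(_ x).
by rewrite !inE eqxx (negbTE xv) !orbF => /esym/eqP.
Qed.

(** Bounds the number of non-injective maps by [m ^ 2 * N ^ (m - 1)]; the factor [N] avoids the
    exponent [m - 1]. *)
Lemma expn_leq_ffact (N m : nat) :
  (N * N ^ m <= N * N ^_ m + m ^ 2 * N ^ m)%N.
Proof.
elim: m => [|m IHm]; first by rewrite ffactn0 expn0; lia.
have le_ffact : (N ^_ m <= N ^ m)%N.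
  elim: {IHm} m => // m IH; rewrite ffactnSr expnSr leq_mul // leq_subr //.
rewrite ffactnSr expnS.
have : (N <= N - m + m)%N by lia.
nia.
Qed.

(* Both sides bound the number of pairs (f, v) with v joined to every f i: an
   injective f has at most n such v, and at most m^2 N^(m-1) maps f are not
   injective. *)
Lemma Kmn_free_sum_nbrs (m n : nat) (V : finType) (F : sgraph V) :
  ~~ contains_copy (Kmn m n) F ->
  (\sum_v #|nbrs F v| ^ m <= #|V| ^ m * (n + m ^ 2))%N.
Proof.
move=> noK; have few (f : {ffun 'I_m -> V}) : injectiveb f -> (#|common_nbrs F f| <= n)%N.
  move=> finj; rewrite leqNgt; apply: contra noK => lt_n.
  by apply/contains_KmnP; exists f => //; apply: ltnW.
have -> : (\sum_v #|nbrs F v| ^ m =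
    \sum_(f : {ffun 'I_m -> V}) #|common_nbrs F f|)%N.
  have fE v (f : {ffun 'I_m -> V}) :
      (f \in ffun_on (mem (nbrs F v))) = (v \in common_nbrs F f).
    by rewrite [RHS]inE; apply/ffun_onP/forallP => h i; have := h i; rewrite inE.
  rewrite (eq_bigr (fun v => \sum_(f : {ffun 'I_m -> V} | v \in common_nbrs F f) 1)%N).
    rewrite (exchange_big_dep xpredT) //=; apply: eq_bigr => f _.
    by rewrite sum1dep_card cardsE.
  move=> v _; rewrite sum1dep_card -[m in LHS]card_ord -card_ffun_on cardsE.
  by apply: eq_card => f; rewrite fE.
have inj_card : (\sum_(f : {ffun 'I_m -> V} | injectiveb f) 1 = #|V| ^_ m)%N.
  by rewrite sum1dep_card card_inj_ffuns card_ord.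
have all_card : (\sum_(f : {ffun 'I_m -> V}) 1 = #|V| ^ m)%N.
  by rewrite sum1_card card_ffun card_ord.
rewrite (bigID (fun f : {ffun _ -> _} => injectiveb f)) /= inj_card in all_card.
rewrite (bigID (fun f : {ffun _ -> _} => injectiveb f)) /=.
have le1 : (\sum_(f : {ffun 'I_m -> V} | injectiveb f) #|common_nbrs F f|
    <= n * #|V| ^_ m)%N.
  by rewrite -inj_card big_distrr /=; apply: leq_sum => f /few; rewrite muln1.
have le2 : (\sum_(f : {ffun 'I_m -> V} | ~~ injectiveb f) #|common_nbrs F f|
    <= #|V| * \sum_(f : {ffun 'I_m -> V} | ~~ injectiveb f) 1)%N.
  by rewrite big_distrr /=; apply: leq_sum => f _; rewrite muln1 max_card.
apply: (leq_trans (leq_add le1 le2)).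
(* With [z] the number of non-injective maps, this gives [#|V| * z <= m ^ 2 * #|V| ^ m]. *)
have := expn_leq_ffact #|V| m.
set z := (\sum_(f | _) 1)%N in all_card *.
by rewrite -all_card; nia.
Qed.

(** Convexity of the power function, by induction: after multiplication by [d], the tangent for [m]
    exceeds the next one by [(m + 1) a ^ m (d - a) ^ 2]. *)
Lemma tangent_expr (R : realType) (m : nat) (a d : R) : 0 <= a -> 0 <= d ->
  a ^+ m.+1 + m.+1%:R * a ^+ m * (d - a) <= d ^+ m.+1.
Proof.
move=> a0 d0; elim: m => [|m IH]; first by rewrite !expr1 expr0; lra.
have := ler_wpM2l d0 IH.
have : 0 <= m.+1%:R * a ^+ m * (d - a) ^+ 2.
  by rewrite mulr_ge0 ?sqr_ge0 // mulr_ge0 ?exprn_ge0.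
rewrite -[m.+2%:R]natr1 !(exprS _ m.+1) [a ^+ m.+1]exprS.
nra.
Qed.

(** * Exponential moment of the number of common neighbours *)

(** If [T] avoids the image of [f], the event asks for [m * #|T|] distinct edges. If [T] meets it, a
    loop would be required and the probability is 0, hence an inequality. *)
Lemma Gnp_prob_subset_common_nbrs (R : realType) (m N : nat) (q : R)
    (f : {ffun 'I_m -> 'I_N}) (T : {set 'I_N}) :
  0 <= q <= 1 -> injectiveb f ->
  Gnp_prob q (fun F => T \subset common_nbrs F f) <= (q ^+ m) ^+ #|T|.
Proof.
move=> q01 /injectiveP finj; have /andP[q0 q1] := q01.
have [/existsP[i fiT]|] := boolP [exists i, f i \in T].
  rewrite /Gnp_prob big_pred0 ?exprn_ge0 // => F.
  apply/negbTE/subsetPn; exists (f i) => //; rewrite inE; apply/forallPn; exists i.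
  by apply/negP => /edges_neq; rewrite eqxx.
move=> /existsPn fT.
pose E := ((fun p : 'I_m * 'I_N => [set f p.1; p.2]%SET) @: finset.setX [set: 'I_m] T)%SET.
have EP : E \subset vpairs 'I_N.
  apply/fintype.subsetP => _ /imsetP[[i v] /setXP[_ /= vT] ->].
  by rewrite inE cards2 (contraNneq _ (fT i)) // => ->.
have cE : #|E| = (m * #|T|)%N.
  rewrite card_in_imset ?cardsX ?cardsT ?card_ord //.
  (* The end in [T] determines [v], and the other end determines [i]. *)
  move=> [i v] [j w] /setXP[_ /= vT] /setXP[_ /= wT] /setP e.
  have neq k u : u \in T -> (f k == u) = false.
    by move=> uT; apply: contraNF (fT k) => /eqP ->.
  have := e v; rewrite !inE eqxx orbT (eq_sym v (f j)) (neq j v vT).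
  move=> /esym/eqP ->; have := e (f i).
  by rewrite !inE eqxx (neq i w wT) orbF => /esym/eqP/finj ->.
rewrite -exprM -cE -Gnp_prob_subset // le_eqVlt; apply/orP; left; apply/eqP.
apply: eq_bigl => F; apply/fintype.subsetP/fintype.subsetP => h.
  move=> _ /imsetP[[i v] /setXP[_ /= vT] ->].
  by have := h v vT; rewrite inE => /forallP.
move=> v vT; rewrite inE; apply/forallP => i; apply: h.
by apply/imsetP; exists (i, v) => //; rewrite inE /= inE.
Qed.

(* Expanding (x + 1)^|S| over the subsets T of S reduces the exponential moment
   to the events "every edge between T and the image of f is present". *)
Lemma Gnp_mean_exp_common_nbrs (R : realType) (m N : nat) (q x : R)
    (f : {ffun 'I_m -> 'I_N}) :
  0 <= q <= 1 -> 0 <= x -> injectiveb f ->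
  Gnp_mean q (fun F => (x + 1) ^+ #|common_nbrs F f|) <= (x * q ^+ m + 1) ^+ N.
Proof.
move=> q01 x0 finj.
rewrite -[N in leRHS]card_ord -cardsT -sum_subsets_expr.
have -> : Gnp_mean q (fun F => (x + 1) ^+ #|common_nbrs F f|) =
  \sum_(T : {set 'I_N}) Gnp_mean q (fun F =>
    x ^+ #|T| * (T \subset common_nbrs F f)%:R).
  by rewrite -Gnp_mean_sum; apply: eq_bigr => F _; rewrite sum_subsets_expr.
apply: ler_sum => T _; rewrite Gnp_meanZ Gnp_mean_indicator finset.subsetT mulr1.
by rewrite exprMn ler_wpM2l ?exprn_ge0 // Gnp_prob_subset_common_nbrs.
Qed.

(** Markov's inequality for the sum of [(x + 1) ^+ #|common_nbrs F f|] over injective [f]: a copy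
    makes some term at least [(x + 1) ^+ n]. *)
Lemma Gnp_prob_Kmn_le (R : realType) (m n N : nat) (q x : R) :
  0 <= q <= 1 -> 0 <= x ->
  (x + 1) ^+ n * Gnp_prob q (fun F : sgraph 'I_N => contains_copy (Kmn m n) F)
    <= N%:R ^+ m * (x * q ^+ m + 1) ^+ N.
Proof.
move=> q01 x0; have /andP[q0 q1] := q01.
have x1 : 1 <= x + 1 by rewrite lerDr.
have X0 k : 0 <= (x + 1) ^+ k by rewrite exprn_ge0 // (le_trans _ x1).
have := @Gnp_markov R N q ((x + 1) ^+ n) (fun F => contains_copy (Kmn m n) F)
  (fun F => \sum_(f : {ffun 'I_m -> 'I_N} | injectiveb f)
     (x + 1) ^+ #|common_nbrs F f|) q01 _ _.
move=> H; apply: (le_trans (H _ _)) => {H} [F|F|]; first exact: sumr_ge0.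
  move=> /contains_KmnP[f finj nf]; rewrite (bigD1 f) //=.
  by rewrite ler_wpDr ?sumr_ge0 // ler_weXn2l.
rewrite Gnp_mean_sum.
apply: (@le_trans _ _ (\sum_(f : {ffun 'I_m -> 'I_N}) (x * q ^+ m + 1) ^+ N)).
  rewrite big_mkcond /=; apply: ler_sum => f _; case: ifP => finj.
    exact: Gnp_mean_exp_common_nbrs.
  by rewrite exprn_ge0 // addr_ge0 // mulr_ge0 ?exprn_ge0.
by rewrite sumr_const card_ffun !card_ord -[leLHS]mulr_natl natrX.
Qed.

(** * Bounding the probability of a copy from below *)

(** By convexity, an average degree above [a = N q - 1 - s] contradicts [Kmn_free_sum_nbrs], so a
    graph without a copy lies in the lower tail of the edge count. The last hypothesis is the
    contradicting inequality divided by [N ^ (m + 1)]. *)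
Lemma Gnp_prob_Kmn_ge (R : realType) (m n N : nat) (q s : R) :
  0 <= q <= 1 -> 0 < s -> (0 < N)%N -> 0 <= N%:R * q - 1 - s ->
  n%:R + m.+1%:R ^+ 2 < N%:R * q ^+ m.+1 - m.+1%:R * q ^+ m * (1 + s) ->
  1 - 2 / s ^+ 2 <=
    Gnp_prob q (fun F : sgraph 'I_N => contains_copy (Kmn m.+1 n) F).
Proof.
move=> q01 s0 N0 a0 big; have /andP[q0 q1] := q01.
rewrite Gnp_probC lerD2l lerN2; apply: Gnp_edges_lower_tail => // F noK.
set a := N%:R * q - 1 - s in a0 *.
have N0r : 0 < N%:R :> R by rewrite ltr0n.
rewrite leNgt; apply/negP => many.
have lo (v : 'I_N) := tangent_expr m a0 (ler0n R #|nbrs F v|).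
have : \sum_v (a ^+ m.+1 + m.+1%:R * a ^+ m * (#|nbrs F v|%:R - a)) <=
    \sum_v #|nbrs F v|%:R ^+ m.+1 :> R by apply: ler_sum => v _; apply: lo.
rewrite big_split /= -mulr_sumr sumrB !sumr_const card_ord -natr_sum sum_deg_edges.
rewrite -[a *+ N]mulr_natl -[_ ^+ _ *+ N]mulr_natl natrM.
have : \sum_v #|nbrs F v|%:R ^+ m.+1 <= N%:R ^+ m.+1 * (n%:R + m.+1%:R ^+ 2) :> R.
  have := Kmn_free_sum_nbrs noK; rewrite card_ord -(ler_nat R) natr_sum natrM natrD !natrX.
  by under eq_bigr do rewrite natrX.
(* The tangent at [N q], evaluated at [a], bounds [a ^ (m + 1)] below by an expression linear in
   [s]. *)
have := tangent_expr m (mulr_ge0 (ltW N0r) q0) a0.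
have : 0 <= m.+1%:R * a ^+ m * (2 * #|edges F|%:R - N%:R * a).
  by rewrite mulr_ge0 ?mulr_ge0 ?exprn_ge0 // subr_ge0 ltW.
have : N%:R ^+ m.+1 * (n%:R + m.+1%:R ^+ 2) <
   N%:R ^+ m.+1 * (N%:R * q ^+ m.+1 - m.+1%:R * q ^+ m * (1 + s)).
  by rewrite ltr_pM2l // exprn_gt0.
move=> H1 H2 H3 H4 H5.
have {H3} : N%:R * ((N%:R * q) ^+ m.+1 + m.+1%:R * (N%:R * q) ^+ m * (a - N%:R * q))
  <= N%:R * a ^+ m.+1 by rewrite ler_pM2l.
have -> : a - N%:R * q = - (1 + s) by rewrite /a; ring.
rewrite !exprMn.
have -> : N%:R * (N%:R ^+ m.+1 * q ^+ m.+1 +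
    m.+1%:R * (N%:R ^+ m * q ^+ m) * - (1 + s)) =
  N%:R ^+ m.+1 * (N%:R * q ^+ m.+1 - m.+1%:R * q ^+ m * (1 + s)) :> R.
  by rewrite !exprS; ring.
lra.
Qed.

Lemma powR_inv_expr (R : realType) (m : nat) (c : R) : 0 <= c ->
  (c `^ (1 / m.+1%:R)) ^+ m.+1 = c.
Proof.
move=> c0; rewrite -powR_mulrn ?powR_ge0 // -powRrM div1r mulVf ?pnatr_eq0 // powRr1 //.
Qed.

Lemma Gnp_prob_le1 (R : realType) (N : nat) (q : R) (A : pred (sgraph 'I_N)) :
  0 <= q <= 1 -> Gnp_prob q A <= 1.
Proof. by move=> q01; rewrite Gnp_probC lerBlDr lerDl Gnp_prob_ge0. Qed.

Lemma Gnp_prob_Kmn_above (R : realType) (m n N : nat) (C q w : R) :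
  0 <= q <= 1 -> 1 <= C -> (2 <= n)%N -> C * n%:R - 1 <= N%:R ->
  4 * (1 + m.+1%:R + m.+1%:R ^+ 2) < w ->
  (1 + w / n%:R) / C <= q ^+ m.+1 ->
  1 - 2 / (w / (4 * m.+1%:R)) ^+ 2 <=
    Gnp_prob q (fun F : sgraph 'I_N => contains_copy (Kmn m.+1 n) F).
Proof.
move=> q01 C1 n2 leN ltw leq; have /andP[q0 q1] := q01.
have n2r : 2 <= n%:R :> R by rewrite (ler_nat R 2).
have m1 : 1 <= m.+1%:R :> R by rewrite ler1n.
have w0 : 0 < w by apply: lt_trans ltw; nra.
have n0 : n%:R != 0 :> R by rewrite pnatr_eq0; case: (n) n2.
have C0 : 0 < C by apply: lt_le_trans C1.
have Cn : 2 <= C * n%:R by nra.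
have N1 : 1 <= N%:R :> R by lra.
have wn : w / n%:R <= w / 2 by rewrite ler_pM2l // lef_pV2 ?posrE //; lra.
have wn0 : 0 <= w / n%:R by rewrite divr_ge0 // ltW.
(* Rounding [N] down costs at most [(1 + w / n) / C <= 1 + w / 2] out of the gain [w]. *)
have excess : n%:R - 1 + w / 2 <= N%:R * q ^+ m.+1.
  have z0 : 0 <= (1 + w / n%:R) / C by rewrite divr_ge0 ?(ltW C0) // addr_ge0.
  have : (C * n%:R - 1) * ((1 + w / n%:R) / C) <= N%:R * q ^+ m.+1.
    by apply: ler_pM => //; lra.
  apply: le_trans.
  have -> : (C * n%:R - 1) * ((1 + w / n%:R) / C) =
      n%:R + w - (1 + w / n%:R) * C^-1.
    by field; rewrite n0 gt_eqF.
  have : (1 + w / n%:R) * C^-1 <= 1 + w / n%:R.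
    by rewrite ler_piMr ?addr_ge0 // invf_le1.
  lra.
set s := w / (4 * m.+1%:R).
have s0 : 0 < s by rewrite divr_gt0 // mulr_gt0 // (lt_le_trans _ m1).
have ms : m.+1%:R * s = w / 4.
  by rewrite /s; field; rewrite addrC natr1 pnatr_eq0.
have qm : q ^+ m <= 1 by rewrite exprn_ile1.
have qm0 : 0 <= q ^+ m by rewrite exprn_ge0.
apply: Gnp_prob_Kmn_ge => //.
- by rewrite -(ltr_nat R) (lt_le_trans _ N1).
- have : N%:R * q ^+ m.+1 <= N%:R * q.
    by rewrite exprS ler_wpM2l // ler_piMr.
  have : s <= w / 4 by rewrite -ms ler_peMl // ltW.
  lra.
(* This loss leaves [w / 4] of the excess, and the hypothesis on [w] makes [w / 4] larger than
   [1 + (m + 1) + (m + 1) ^ 2]. *)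
- have : m.+1%:R * q ^+ m * (1 + s) <= m.+1%:R + w / 4.
    rewrite -ms -[X in _ <= X + _]mulr1 -mulrDr ler_wpM2r ?addr_ge0 ?(ltW s0) //.
    by rewrite ler_piMr.
  lra.
Qed.

(** * Bounding the probability of a copy from above *)

Lemma Gnp_prob_Kmn_below (R : realType) (m n N : nat) (C q d : R) :
  0 <= q <= 1 -> 0 <= C -> N%:R <= C * n%:R ->
  0 <= d <= 1 -> C * q ^+ m <= 1 - d ->
  Gnp_prob q (fun F : sgraph 'I_N => contains_copy (Kmn m n) F) <=
    (C * n%:R) ^+ m * expR (- (n%:R * d ^+ 2 / 4)).
Proof.
move=> q01 C0 leN /andP[d0 d1] hq; have /andP[q0 q1] := q01.
(* The exponent divided by [n] is [x (1 - d) - x / (x + 1) <= x ^ 2 - d x]; the choice [x = d / 2]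
   minimises the right side, with value [- d ^ 2 / 4]. *)
pose x := d / 2.
have x0 : 0 <= x by rewrite divr_ge0.
have x1 : 0 < x + 1 by rewrite ltr_wpDl.
have bound := @Gnp_prob_Kmn_le R m n N q x q01 x0.
have up : (x * q ^+ m + 1) ^+ N <= expR (n%:R * (x * (1 - d))).
  apply: (@le_trans _ _ (expR (x * q ^+ m) ^+ N)).
    apply: lerXn2r; rewrite ?nnegrE ?expR_ge0 //.
      by rewrite addr_ge0 // mulr_ge0 // exprn_ge0.
    by rewrite addrC expR_ge1Dx.
  rewrite -expRM_natl ler_expR.
  have : N%:R * q ^+ m <= n%:R * (1 - d).
    apply: (@le_trans _ _ (C * n%:R * q ^+ m)).
      by rewrite ler_wpM2r // exprn_ge0.
    by rewrite mulrAC mulrC ler_wpM2l.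
  by move=> /(ler_wpM2l x0); rewrite mulrCA [x * (n%:R * _)]mulrCA.
(* [1 / (1 + x) = 1 - x / (1 + x) <= exp (- x / (1 + x))] *)
have low : expR (n%:R * (x / (x + 1))) <= (x + 1) ^+ n.
  rewrite expRM_natl; apply: lerXn2r; rewrite ?nnegrE ?expR_ge0 ?(ltW x1) //.
  rewrite -[leLHS]invrK -expRN -[leRHS]invrK lef_pV2 ?posrE ?invr_gt0 ?expR_gt0 //.
  apply: le_trans (expR_ge1Dx _); rewrite le_eqVlt; apply/orP; left; apply/eqP.
  by field; rewrite gt_eqF.
set P := Gnp_prob _ _ in bound *.
have P0 : 0 <= P by apply: Gnp_prob_ge0.
have {}bound : expR (n%:R * (x / (x + 1))) * P <=
    (C * n%:R) ^+ m * expR (n%:R * (x * (1 - d))).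
  apply: (le_trans (ler_wpM2r P0 low)); apply: (le_trans bound).
  apply: ler_pM => //; rewrite ?exprn_ge0 //.
    by rewrite addr_ge0 // mulr_ge0 // exprn_ge0.
  by apply: lerXn2r; rewrite ?nnegrE // mulr_ge0.
rewrite -(ler_pM2l (expR_gt0 (n%:R * (x / (x + 1))))); apply: (le_trans bound).
rewrite [leRHS]mulrCA ler_wpM2l ?exprn_ge0 ?mulr_ge0 // -expRD ler_expR.
rewrite -mulrA -mulrBr ler_wpM2l //.
have -> : d = 2 * x by rewrite /x; field.
have : x / (x + 1) = x - x ^+ 2 / (x + 1) by field; rewrite gt_eqF.
have : x ^+ 2 / (x + 1) <= x ^+ 2.
  by rewrite ler_piMr ?sqr_ge0 // invf_le1 // lerDr.
nra.
Qed.

(** * The two thresholds *)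

Local Open Scope classical_set_scope.

Theorem theorem4 (R : realType) (m : nat) (c : R) (hm : (1 <= m)%N) (hc : 1 < c) :
  exists2 M : R, 0 < M &
    forall omega : nat -> R,
      omega n @[n --> \oo] --> +oo ->
      (\forall n \near \oo,
         0 <= 1 / (c `^ (1 / m%:R)) * (1 + omega n / n%:R) <= 1) ->
      weak_Ramsey_upper_threshold (fun n => Kmn m n)
        (fun n => Num.truncn (c * 2 ^+ m * n%:R))
        (fun n => 1 / (c `^ (1 / m%:R)) * (1 + omega n / n%:R))
      /\
      weak_Ramsey_lower_threshold (fun n => Kmn m n)
        (fun n => Num.truncn (c * 2 ^+ m * n%:R))
        (fun n => 1 / (c `^ (1 / m%:R)) * (1 - Num.sqrt (M * ln n%:R / n%:R))).
Proof.
(* The original [m] is now [m.+1], so the witness is [4 (m + 1)] in terms of the original. *)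
case: m hm => // m _; exists (4 * m.+2%:R) => [|omega omega_oo _].
  by rewrite mulr_gt0.
have c0 : 0 < c by apply: lt_trans hc.
set K := c `^ _.
have K0 : 0 < K by apply: powR_gt0.
have Km : K ^+ m.+1 = c by apply: powR_inv_expr; apply: ltW.
set C := c * 2 ^+ m.+1.
have C1 : 1 <= C.
  by rewrite -[1]mulr1 ler_pM // ?(ltW hc) // exprn_ege1 // ler1n.
have C0 : 0 < C by apply: lt_le_trans C1.
have qE (z : R) : (1 / K * z / 2) ^+ m.+1 = z ^+ m.+1 / C.
  by rewrite !exprMn !exprVn expr1n Km /C invfM; ring.
have half01 (p : R) : 0 <= p <= 1 -> 0 <= p / 2 <= 1 by move=> /andP[? ?]; lra.
split=> p p01 near_p; apply/cvgrPdist_le => e e0; near=> n.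
- have n2 : (2 <= n)%N by near: n; apply: nbhs_infty_ge.
  have hp : 1 / K * (1 + omega n / n%:R) <= p n by near: n.
  have w1 : 4 * (1 + m.+1%:R + m.+1%:R ^+ 2) + 1 <= omega n.
    by near: n; move/cvgryPge : omega_oo; apply.
  have w2 : 32 * m.+1%:R ^+ 2 / e <= omega n.
    by near: n; move/cvgryPge : omega_oo; apply.
  have q01 := half01 _ (p01 n).
  have m1 : 1 <= m.+1%:R :> R by rewrite ler1n.
  have w0 : 1 <= omega n by apply: le_trans w1; nra.
  rewrite ger0_norm ?subr_ge0 ?Gnp_prob_le1 // lerBlDl -lerBlDr.
  have z1 : 1 <= 1 + omega n / n%:R by rewrite lerDl divr_ge0 // (le_trans _ w0).
  apply: le_trans (@Gnp_prob_Kmn_above R m n _ C (p n / 2) (omega n) q01 C1 n2 _ _ _).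
  + rewrite lerD2l lerN2.
    have -> : 2 / (omega n / (4 * m.+1%:R)) ^+ 2 =
        32 * m.+1%:R ^+ 2 / omega n ^+ 2.
      by field; rewrite addrC natr1 pnatr_eq0 gt_eqF // (lt_le_trans _ w0).
    rewrite ler_pdivrMr ?exprn_gt0 ?(lt_le_trans _ w0) //.
    move: w2; rewrite ler_pdivrMr // => /le_trans; apply.
    rewrite mulrC ler_pM2l // expr2 ler_peMl //; lra.
  + by rewrite lerBlDr natr1 ltW // truncnS_gt.
  + by apply: lt_le_trans w1; rewrite ltrDl.
  (* A number that is at least 1 is at most its power [m.+1]. *)
  + apply: (@le_trans _ _ ((1 / K * (1 + omega n / n%:R) / 2) ^+ m.+1)).
      by rewrite qE ler_pM2r ?invr_gt0 // exprS ler_peMr ?exprn_ege1 // (le_trans _ z1).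
    apply: lerXn2r; rewrite ?nnegrE.
    * by rewrite !mulr_ge0 ?invr_ge0 ?(ltW K0) // (le_trans _ z1).
    * by have /andP[] := q01.
    * by rewrite ler_pM2r.
- have n1 : (1 <= n)%N by near: n; apply: nbhs_infty_ge.
  have hp : p n <= 1 / K * (1 - Num.sqrt (4 * m.+2%:R * ln n%:R / n%:R)) by near: n.
  (* The final bound on the probability is [C ^ (m + 1) / n]. *)
  have he : C ^+ m.+1 / e <= n%:R by near: n; apply: nbhs_infty_ger.
  have q01 := half01 _ (p01 n).
  have n1r : 1 <= n%:R :> R by rewrite ler1n.
  have n0r : 0 < n%:R :> R by rewrite ltr0n.
  rewrite sub0r normrN ger0_norm ?Gnp_prob_ge0 //.
  set d := Num.sqrt _ in hp.
  have d0 : 0 <= d by apply: sqrtr_ge0.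
  have dE : d ^+ 2 = 4 * m.+2%:R * ln n%:R / n%:R.
    by rewrite sqr_sqrtr // divr_ge0 // mulr_ge0 ?ln_ge0 // mulr_ge0.
  have pn0 : 0 <= p n by have /andP[] := p01 n.
  (* The threshold lies above [p n >= 0], so it is nonnegative at this [n]. *)
  have d1 : d <= 1.
    by have := le_trans pn0 hp; rewrite pmulr_rge0 ?subr_ge0 // divr_gt0.
  have d01 : 0 <= d <= 1 by rewrite d0.
  apply: le_trans (@Gnp_prob_Kmn_below R m.+1 n _ C (p n / 2) d q01 (ltW C0) _ d01 _) _.
  + by rewrite truncn_le // mulr_ge0 // ltW.
  + apply: (@le_trans _ _ (C * (1 / K * (1 - d) / 2) ^+ m.+1)).
      rewrite ler_pM2l //; apply: lerXn2r; rewrite ?nnegrE ?ler_pM2r //.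
      * by rewrite divr_ge0.
      * by rewrite divr_ge0 // mulr_ge0 ?subr_ge0 // divr_ge0 // ltW.
    (* Here [(1 - d) ^ (m + 1) <= 1 - d], as [1 - d] lies between 0 and 1. *)
    rewrite qE mulrCA mulfV ?gt_eqF // mulr1 exprS ler_piMr ?subr_ge0 //.
    by rewrite exprn_ile1 ?subr_ge0 // gerBl.
  + rewrite dE.
    have -> : n%:R * (4 * m.+2%:R * ln n%:R / n%:R) / 4 = m.+2%:R * ln n%:R :> R.
      by field; rewrite gt_eqF.
    rewrite expRN expRM_natl lnK ?posrE // exprMn [n%:R ^+ m.+2]exprS.
    rewrite -mulf_div mulfV ?mulr1; last by rewrite expf_neq0 // gt_eqF.
    by rewrite ler_pdivrMr // mulrC -ler_pdivrMr.
Unshelve. all: by end_near.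
Qed.
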